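(* If $\mathcal{A}\subseteq\mathbb{Z}^+$ is a finite nonempty set, then \[ \omega_{\mathbb{N}}\Big(\prod_{\substack{a,b\in\mathcal{A}\\ a\ne b}}(a^2+ab+b^2)\Big)>\frac{\log|\mathcal{A}|-\log 146}{2\log 3}. \]
   Context: $\mathbb{Z}^+$ is the set of positive integers. For a positive integer $N$, $\omega_{\mathbb{N}}(N)$ denotes the number of distinct (positive rational) prime divisors of $N$. An empty product equals $1$. *)

(* Defs.v *)
From mathcomp Require Import all_boot.

Set Implicit Arguments.
Unset Strict Implicit.
Unset Printing Implicit Defensive.

Definition omega (N : nat) : nat := size (primes N).

(* Main.v *)
(** Split the prime p in the Eisenstein integers: if x, y are prime to p and
    p | x^2 + xy + y^2 then x^3 = y^3 mod p, and x <> y mod p unless p = 3.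
    Since x^3 = c has at most three roots mod p, three colours suffice to
    separate all such pairs.  Colour each a in A, for each of the s primes p
    dividing the product, by the colour of the p'-part of a.  If a <> b got the
    same colours everywhere, then with d = gcd(a, b) the number
    (a^2 + ab + b^2) / d^2 would be divisible by no prime but 3, and not by 9,
    so it would be at most 3, forcing a = b.  Hence |A| <= 3^s, which is
    stronger than |A| < 146 * 9^s. *)
Require Import Defs.
From mathcomp Require Import all_boot all_order all_algebra.
From mathcomp Require Import finmap.
From mathcomp Require Import reals exp.
From mathcomp Require Import zify ring lra.
Import Order.TTheory GRing.Theory Num.Theory.
Local Open Scope fset_scope.
Local Open Scope ring_scope.

Definition eisenstein_norm (a b : nat) : nat := (a ^ 2 + a * b + b ^ 2)%N.

(** A list in the order of [enum F], so that it depends on [x] only through [x ^+ 3] and positions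
    in it can serve as colours. *)
Definition cube_fiber (F : finFieldType) (x : F) : seq F :=
  [seq y <- enum F | y ^+ 3 == x ^+ 3].

Lemma size_cube_fiber (F : finFieldType) (x : F) : (size (cube_fiber F x) <= 3)%N.
Proof.
have sz : size ('X^3 - (x ^+ 3)%:P : {poly F}) = 4%N by rewrite size_XnsubC.
have nz : 'X^3 - (x ^+ 3)%:P != 0 :> {poly F} by rewrite -size_poly_eq0 sz.
rewrite -ltnS -sz; apply: max_poly_roots => //.
  apply/allP => y; rewrite mem_filter => /andP[/eqP xy _].
  by rewrite /root !hornerE xy subrr.
by rewrite filter_uniq // enum_uniq.
Qed.

Lemma mem_cube_fiber (F : finFieldType) (x : F) : x \in cube_fiber F x.
Proof. by rewrite mem_filter eqxx mem_enum. Qed.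

Definition color (p a : nat) : nat := index (a%:R : 'F_p) (cube_fiber 'F_p a%:R).

Lemma color_lt3 (p a : nat) : (color p a < 3)%N.
Proof.
by apply: leq_trans (size_cube_fiber _ (a%:R : 'F_p)); rewrite index_mem mem_cube_fiber.
Qed.

(** Equal cubes mod [p] give the same list, so equal positions in it give equal residues; the norm
    is then 3x^2 with x invertible. *)
Lemma color_eq_prime3 (p a b : nat) : prime p -> ~~ (p %| a)%N ->
  (p %| eisenstein_norm a b)%N -> color p a = color p b -> p = 3%N.
Proof.
move=> pp pa pN.
have dvdF m : (p %| m)%N = ((m%:R : 'F_p) == 0) by rewrite (dvdn_pcharf (pchar_Fp pp)).
rewrite dvdF in pa; move: pN.
rewrite dvdF /eisenstein_norm !natrD natrM !natrX /color.
set x : 'F_p := a%:R in pa *; set y : 'F_p := b%:R => /eqP N0.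
have xy3 : x ^+ 3 = y ^+ 3.
  apply/eqP; rewrite -subr_eq0; apply/eqP.
  by transitivity ((x - y) * (x ^+ 2 + x * y + y ^+ 2)); [ring | rewrite N0 mulr0].
have fE : cube_fiber 'F_p y = cube_fiber 'F_p x by rewrite /cube_fiber xy3.
rewrite fE => ixy.
have {ixy} xy : x = y.
  by rewrite -(nth_index 0 (mem_cube_fiber _ x)) ixy nth_index // -fE mem_cube_fiber.
have : 3%:R * x ^+ 2 = 0 by rewrite -[RHS]N0 -xy; ring.
move/eqP; rewrite mulf_eq0 expf_eq0 /= (negPf pa) orbF -dvdF.
by rewrite dvdn_prime2 // => /eqP.
Qed.

Lemma eisenstein_norm_mul (d a b : nat) :
  eisenstein_norm (d * a) (d * b) = (d ^ 2 * eisenstein_norm a b)%N.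
Proof. by rewrite /eisenstein_norm; ring. Qed.

Lemma eisenstein_norm_mod9 (a b : nat) :
  coprime a b -> ~~ (9 %| eisenstein_norm a b)%N.
Proof.
move=> cab; apply/negP => N9.
suff /andP[a3 b3] : (3 %| a)%N && (3 %| b)%N.
  by have := dvdn_gcd 3 a b; rewrite (eqP cab) a3 b3.
(* Equal remainders r = t make the middle bracket 3r(k + l), leaving 3r^2 mod 9; unequal ones leave
   a norm prime to 3. *)
have expand k r l t : eisenstein_norm (k * 3 + r) (l * 3 + t) =
    (9 * eisenstein_norm k l + 3 * (2 * k * r + k * t + l * r + 2 * l * t)
     + eisenstein_norm r t)%N.
  by rewrite /eisenstein_norm; ring.
move: N9; rewrite (divn_eq a 3) (divn_eq b 3) expand.
move: (eisenstein_norm (a %/ 3) _) (ltn_pmod a (isT : 0 < 3)%N) (ltn_pmod b (isT : 0 < 3)%N).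
move=> K; case: (a %% 3)%N => [|[|[|//]]] _; case: (b %% 3)%N => [|[|[|//]]] _;
  rewrite /eisenstein_norm; lia.
Qed.

(** If [p] divided one argument, the norm would reduce mod [p] to the square of the other, so [p]
    would divide both. *)
Lemma dvd_eisenstein_norm_coprime (p a b : nat) : prime p -> coprime a b ->
  (p %| eisenstein_norm a b)%N -> ~~ (p %| a)%N /\ ~~ (p %| b)%N.
Proof.
move=> pp cab pN.
have ab : ~~ ((p %| a) && (p %| b))%N.
  by rewrite -dvdn_gcd (eqP cab) dvdn1 neq_ltn prime_gt1 ?orbT.
split; apply: contra ab => H; rewrite H ?andbT /=; move: pN; rewrite /eisenstein_norm.
  by rewrite dvdn_addr ?Euclid_dvdX ?andbT // dvdn_add // ?dvdn_mulr // dvdn_exp.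
have pab : (p %| a * b)%N by rewrite dvdn_mull.
by rewrite dvdn_addl ?(dvdn_addl _ pab) Euclid_dvdX ?H // andbT.
Qed.

Lemma eisenstein_norm_gt0 (a b : nat) : (0 < a)%N -> (0 < eisenstein_norm a b)%N.
Proof. by rewrite /eisenstein_norm !addn_gt0 expn_gt0 => ->. Qed.

Lemma partn_compl_coprime (p d a : nat) : (0 < d)%N -> (0 < a)%N -> prime p ->
  ~~ (p %| a)%N -> ((d * a)`_p^' = d`_p^' * a)%N.
Proof.
move=> d0 a0 pp pa; rewrite partnM // [(a`_ _)%N]part_pnat_id //.
by rewrite p'natE.
Qed.

Lemma color_inj (a b : nat) : (0 < a)%N -> (0 < b)%N ->
  (forall p, p \in primes (eisenstein_norm a b) ->
     color p (a`_p^')%N = color p (b`_p^')%N) -> a = b.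
Proof.
move=> a0 b0 col.
have d0 : (0 < gcdn a b)%N by rewrite gcdn_gt0 a0.
set d := gcdn a b in d0.
have [a1 aE] : exists a1, a = (d * a1)%N.
  by exists (a %/ d)%N; rewrite mulnC divnK // dvdn_gcdl.
have [b1 bE] : exists b1, b = (d * b1)%N.
  by exists (b %/ d)%N; rewrite mulnC divnK // dvdn_gcdr.
have cab : coprime a1 b1.
  by rewrite /coprime -(eqn_pmul2l d0) muln_gcdr -aE -bE muln1.
have a10 : (0 < a1)%N by move: a0; rewrite aE muln_gt0 d0.
have b10 : (0 < b1)%N by move: b0; rewrite bE muln_gt0 d0.
have N0 := eisenstein_norm_gt0 a1 b1 a10.
have only3 p : prime p -> (p %| eisenstein_norm a1 b1)%N -> p = 3%N.
  move=> pp pN; have [pa pb] := dvd_eisenstein_norm_coprime p a1 b1 pp cab pN.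
  (* The p'-parts of [a] and [b] are [a1] and [b1] times this unit mod [p], even when [p] divides
     [d]. *)
  have pd : ~~ (p %| d`_p^')%N by rewrite -p'natE // part_pnat.
  have pab : p \in primes (eisenstein_norm a b).
    by rewrite mem_primes pp eisenstein_norm_gt0 //= aE bE eisenstein_norm_mul dvdn_mull.
  have := col p pab; rewrite aE bE !partn_compl_coprime //.
  apply: color_eq_prime3 => //; first by rewrite Euclid_dvdM // negb_or pd.
  by rewrite eisenstein_norm_mul dvdn_mull.
have le3 : (eisenstein_norm a1 b1 <= 3)%N.
  have N3 : (3%N).-nat (eisenstein_norm a1 b1).
    by apply/pnatP => // p pp /(only3 p pp) ->.
  rewrite -(part_pnat_id N3) p_part.
  have := eisenstein_norm_mod9 a1 b1 cab; rewrite -[9%N]/(3 ^ 2)%N pfactor_dvdn // -ltnNge.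
  by case: (logn 3 _) => [|[|]].
(* For positive arguments each of the three terms of the norm is at least 1. *)
have [a11 b11] : a1 = 1%N /\ b1 = 1%N by rewrite /eisenstein_norm in le3; split; nia.
by rewrite aE bE a11 b11.
Qed.

Lemma card_le_exp_omega (A : {fset nat}) : (forall a : nat, a \in A -> (0 < a)%N) ->
  (#|` A| <= 3 ^ omega (\prod_(a <- A) \prod_(b <- A | a != b) eisenstein_norm a b))%N.
Proof.
move=> Apos; rewrite /omega; set P := (\prod_(a <- A) _)%N.
have P0 : (0 < P)%N.
  rewrite /P big_seq prodn_cond_gt0 // => a aA.
  by rewrite prodn_cond_gt0 // => b _; rewrite eisenstein_norm_gt0 ?Apos.
(* The vector of colours of [a], one for each prime factor of [P]; the default of [nth] is never
   reached. *)
pose f (a : nat) : {ffun 'I_(size (primes P)) -> 'I_3} :=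
  [ffun i : 'I_(size (primes P)) => let p := nth 0%N (primes P) i in Ordinal (color_lt3 p (a`_p^')%N)].
have f_inj : {in A &, injective f}.
  move=> a b aA bA fab; apply/eqP/negPn/negP => nab; move/eqP: (nab); apply.
  apply: color_inj => [||p pN]; rewrite ?Apos //.
  have pP : p \in primes P.
    move: pN; rewrite !mem_primes P0 => /and3P[-> _ /= pN].
    (* Since [a != b], the norm of the pair is itself a factor of [P]. *)
    rewrite /P (big_fsetD1 a) //= dvdn_mulr // (big_rem b) /= ?nab ?dvdn_mulr //.
  have ip : (index p (primes P) < size (primes P))%N by rewrite index_mem.
  move/ffunP/(_ (Ordinal ip)): fab; rewrite !ffunE /= => /(congr1 val) /=.
  by rewrite nth_index.
have := max_card (mem (map f A)); rewrite card_ffun !card_ord.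
by rewrite (card_uniqP _) ?size_map // map_inj_in_uniq // fset_uniq.
Qed.

Theorem corollary2 (R : realType) (A : {fset nat})
    (Apos : forall a : nat, a \in A -> (0 < a)%N) (An0 : A != fset0) :
  (ln (#|` A|%:R) - ln 146) / (2 * ln 3) <
  (omega (\prod_(a <- A) \prod_(b <- A | a != b) (a ^ 2 + a * b + b ^ 2))%N)%:R
  :> R.
Proof.
have := card_le_exp_omega A Apos; rewrite /eisenstein_norm; set w := omega _ => Aw.
have ln3 : 0 < ln 3 :> R by rewrite ln_gt0 // ltr1n.
have ln146 : 0 < ln 146 :> R by rewrite ln_gt0 // ltr1n.
have lnA : ln #|` A|%:R <= w%:R * ln 3 :> R.
  rewrite mulr_natl -lnXn // -natrX ler_ln ?posrE ?ltr0n ?expn_gt0 ?ler_nat //.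
  by rewrite cardfs_gt0.
have w0 : 0 <= w%:R :> R by [].
(* Strictness comes from [ln 146 > 0], and w ln 3 <= 2w ln 3 absorbs the factor 2. *)
rewrite ltr_pdivrMr ?mulr_gt0 //; nra.
Qed.
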